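(* Let $n\ge 2$ be an integer. For every pairwise distinct $f_1,\ldots,f_n\in L_1$ there is a linear operator $T:L_1\to L_2$ such that $$\frac{\|T(f_i)-T(f_j)\|_2}{\|f_i-f_j\|_1}\ \ge\ \frac{1}{\sqrt{8\log n}}\qquad\text{for all } 1\le i<j\le n,$$ and $$\frac{1}{\binom{n}{2}}\sum_{1\le i<j\le n}\left(\frac{\|T(f_i)-T(f_j)\|_2}{\|f_i-f_j\|_1}\right)^{1/2}\le 10.$$
   Context: $L_p$ denotes the real space $L_p[0,1]$ (with Lebesgue measure) with its usual norm $\|\cdot\|_p$; $L_2$ serves as a Hilbert space. $\log$ is the natural logarithm. *)

(* Defs.v *)
From HB Require Import structures.
From mathcomp Require Import all_boot all_order all_algebra.
From mathcomp Require Import all_classical all_reals all_analysis.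
From mathcomp Require Import measurable_realfun ess_sup_inf.

Set Implicit Arguments.
Unset Strict Implicit.
Unset Printing Implicit Defensive.
Import Order.TTheory GRing.Theory Num.Theory.
Import numFieldNormedType.Exports.

Local Open Scope classical_set_scope.
Local Open Scope ring_scope.

Section ae_Lnorm.
Context d (T : measurableType d) (R : realType).
Variables (mu : {measure set T -> \bar R}) (p : \bar R) (p1 : (1 <= p)%E).

Lemma ae_eq_Lnorm (f g : T -> R) : measurable_fun setT f ->
  measurable_fun setT g -> f = g %[ae mu] ->
  ('N[mu]_p[EFin \o f] = 'N[mu]_p[EFin \o g])%E.
Proof.
have mpow r (h : T -> \bar R) : measurable_fun setT h ->
    measurable_fun setT (fun x => `|h x| `^ r)%E.
  move=> mh; apply: (@measurableT_comp _ _ _ _ _ _ (fun x => x `^ r)%E) => //=.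
    exact: (measurableT_comp (measurable_poweR _)).
  exact: measurableT_comp.
move=> mf mg fg; rewrite unlock /Lnorm; case: p p1 => [r r1| _ |//].
- congr poweR; apply: ge0_ae_eq_integral => //.
  + exact/mpow/measurable_EFinP.
  + exact/mpow/measurable_EFinP.
  + by move=> x _; exact: poweR_ge0.
  + by move=> x _; exact: poweR_ge0.
  + exact: (ae_eq_comp (fun y => `|y%:E| `^ r)%E fg).
- case: ifPn => // _; apply: eq_ess_sup.
  by move: fg; apply: filterS => x /= /(_ I) ->.
Qed.
End ae_Lnorm.


Section Lspace.
Context d (T : measurableType d) (R : realType).
Variables (mu : {measure set T -> \bar R}) (p : \bar R) (p1 : (1 <= p)%E).
Local Notation L := (LspaceType mu p1).
Local Notation Lf := (LfunType mu p1).
Local Notation Q := {mfun_ mu, T >-> measurableTypeR R}.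
Local Open Scope quotient_scope.

Local Notation mfunR := {mfun T >-> measurableTypeR R}.

Lemma repr_pi_ae (f : mfunR) : repr (\pi_Q f) = f %[ae mu].
Proof. by have /eqP := reprK (\pi_Q f); rewrite eqmodE => /asboolP. Qed.

(* [R] and [measurableTypeR R] carry the same sigma-algebra under different
   displays, so that [LfunType] and [LspaceType] do not share their measurable
   functions on the nose. *)
Lemma measurable_Lfun (f : Lf) :
  measurable_fun setT (f : T -> measurableTypeR R).
Proof. exact: (@measurable_funPT _ _ T R f). Qed.

Definition mfun_of_Lfun (f : Lf) : mfunR :=
  HB.pack_for mfunR (f : T -> measurableTypeR R)
    (isMeasurableFun.Build _ _ T (measurableTypeR R) f (measurable_Lfun f)).

Lemma measurable_Lspace (f : L) : measurable_fun setT (f : T -> R).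
Proof. exact: (@measurable_funPT _ _ T _ (repr (f : Q))). Qed.

Lemma Lclass_subproof (f : Lf) : finite_norm mu p (\pi_Q (mfun_of_Lfun f) : Q).
Proof.
rewrite /finite_norm (@ae_eq_Lnorm _ _ _ mu p p1 _ f).
- exact: Lfunction_finite.
- exact: (@measurable_funPT _ _ T _ (repr (\pi_Q (mfun_of_Lfun f)))).
- exact: measurable_funPT.
- exact: (repr_pi_ae (mfun_of_Lfun f)).
Qed.

Definition Lclass (f : Lf) : L :=
  HB.pack_for L (\pi_Q (mfun_of_Lfun f) : Q)
    (isFinLebesgue.Build _ _ _ mu p p1 _ (Lclass_subproof f)).

Lemma mem_Lspace (f : L) : (f : T -> R) \in Lfun mu p.
Proof.
apply/andP; rewrite !inE/=; split; first exact: measurable_Lspace.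
exact: Lebesgue_finite.
Qed.

Definition Lrepr (f : L) : Lf := Lfun_Sub p1 (mem_Lspace f).

Lemma LclassK (f : Lf) : Lrepr (Lclass f) = f %[ae mu].
Proof. exact: (repr_pi_ae (mfun_of_Lfun f)). Qed.

Lemma Lspace_inj (f g : L) : f = g :> Q -> f = g.
Proof.
case: f g => [f [[mf]]] [g [[mg]]] /= fg; move: mf mg; rewrite fg => mf mg.
by rewrite (Prop_irrelevance mf mg).
Qed.

Lemma eq_Lclass (f g : Lf) : f = g %[ae mu] -> Lclass f = Lclass g.
Proof.
move=> fg; apply: Lspace_inj; apply/eqmodP.
by apply/asboolP; exact: fg.
Qed.

Lemma LreprK : cancel Lrepr Lclass.
Proof.
move=> f; apply: Lspace_inj; rewrite -[RHS]reprK; apply/eqmodP/asboolP.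
exact: ae_eq_refl.
Qed.

Lemma Lclass_eq (f g : Lf) : Lclass f = Lclass g -> f = g %[ae mu].
Proof.
move=> fg; apply: (ae_eq_trans (ae_eq_sym (LclassK f))).
by rewrite fg; exact: LclassK.
Qed.

HB.instance Definition _ := gen_eqMixin L.
HB.instance Definition _ := gen_choiceMixin L.

Definition addL (f g : L) := Lclass (Lrepr f + Lrepr g).
Definition oppL (f : L) := Lclass (- Lrepr f).
Definition scaleL (a : R) (f : L) := Lclass (a *: Lrepr f).

Let addL_class (f g : Lf) : addL (Lclass f) (Lclass g) = Lclass (f + g).
Proof.
apply: eq_Lclass; move: (LclassK f) (LclassK g); apply: filterS2.
by move=> x /(_ I) fx /(_ I) gx _; exact: (congr2 +%R fx gx).
Qed.

Let oppL_class (f : Lf) : oppL (Lclass f) = Lclass (- f).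
Proof.
apply: eq_Lclass; move: (LclassK f); apply: filterS.
by move=> x /(_ I) fx _; exact: (congr1 -%R fx).
Qed.

Let scaleL_class a (f : Lf) : scaleL a (Lclass f) = Lclass (a *: f).
Proof.
apply: eq_Lclass; move: (LclassK f); apply: filterS.
by move=> x /(_ I) fx _; exact: (congr1 ( *%R a) fx).
Qed.

Let addLA : associative addL.
Proof.
move=> f g h; rewrite -(LreprK f) -(LreprK g) -(LreprK h).
by rewrite !addL_class addrA.
Qed.

Let addLC : commutative addL.
Proof. by move=> f g; rewrite /addL addrC. Qed.

Let add0L : left_id (Lclass 0) addL.
Proof. by move=> f; rewrite -(LreprK f) addL_class add0r. Qed.

Let addNL : left_inverse (Lclass 0) oppL addL.
Proof. by move=> f; rewrite -(LreprK f) oppL_class addL_class addNr. Qed.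

HB.instance Definition _ := GRing.isZmodule.Build L addLA addLC add0L addNL.

Lemma LclassD (f g : Lf) : Lclass f + Lclass g = Lclass (f + g).
Proof. exact: addL_class. Qed.

Let scaleLA a b f : scaleL a (scaleL b f) = scaleL (a * b) f.
Proof. by rewrite -(LreprK f) !scaleL_class scalerA. Qed.

Let scale1L : left_id 1 scaleL.
Proof. by move=> f; rewrite -(LreprK f) scaleL_class scale1r. Qed.

Let scaleLDr : right_distributive scaleL +%R.
Proof.
move=> a f g; rewrite -(LreprK f) -(LreprK g).
by rewrite LclassD !scaleL_class LclassD scalerDr.
Qed.

Let scaleLDl f : {morph scaleL^~ f : a b / a + b}.
Proof.
by move=> a b; rewrite -(LreprK f) !scaleL_class LclassD scalerDl.
Qed.

HB.instance Definition _ := GRing.Zmodule_isLmodule.Build R L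
  scaleLA scale1L scaleLDr scaleLDl.

Lemma LclassZ a (f : Lf) : a *: Lclass f = Lclass (a *: f).
Proof. exact: scaleL_class. Qed.

Definition normL (f : L) : R := fine ('N[mu]_p[EFin \o f])%E.

Lemma normL_class (f : Lf) : normL (Lclass f) = fine ('N[mu]_p[EFin \o f])%E.
Proof.
congr fine; apply: ae_eq_Lnorm => //; first exact: measurable_Lspace.
exact: LclassK.
Qed.

Let ler_normLD f g : normL (f + g) <= normL f + normL g.
Proof.
rewrite -(LreprK f) -(LreprK g) LclassD !normL_class.
exact: ler_LnormD.
Qed.

Let normLZ a f : normL (a *: f) = `|a| * normL f.
Proof.
rewrite -(LreprK f) LclassZ !normL_class.
apply: EFin_inj; rewrite EFinM !finite_norm_fine.
exact: LnormZ.
Qed.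

Let normL_eq0 f : normL f = 0 -> f = 0.
Proof.
rewrite -(LreprK f) normL_class => /fine_Lnormr_eq0 f0.
exact: eq_Lclass.
Qed.

HB.instance Definition _ := Lmodule_isNormed.Build R L ler_normLD normLZ normL_eq0.

Lemma Lnorm_LspaceE (f : L) : `|f| = fine ('N[mu]_p[EFin \o f])%E.
Proof. by []. Qed.

End Lspace.

(* Restricting the measure instead of the domain: two functions on R define the
   same element of L_p as soon as they agree almost everywhere on the unit
   interval. *)
Definition lebesgue01 (R : realType) :
    {measure set (measurableTypeR R) -> \bar R} :=
  mrestr (@lebesgue_measure R) (measurable_itv `[0, 1]).

Notation L1 R := (LspaceType1 (lebesgue01 R)).
Notation L2 R := (LspaceType2 (lebesgue01 R)).

(* Main.v *)
Require Import Defs.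
From HB Require Import structures.
From mathcomp Require Import all_boot all_order all_algebra.
From mathcomp Require Import all_classical all_reals all_analysis.
From mathcomp Require Import measurable_realfun ring lra.
Import Order.TTheory GRing.Theory Num.Theory.
Import numFieldNormedType.Exports.

(** Partition the space according to the relative order of the values
    [f_1 x, .., f_n x].  On a cell [A] every difference [f_i - f_j] has constant
    sign, so [`|f_i - f_j|] is the sum over the cells of [`|\int_A (f_i - f_j)|].
    For weights [w_A >= 0] the operator
    [S g = \sum_A sqrt (w_A) (\int_A g) 1_A / sqrt (mu A)] then satisfies
    [`|S g|^2 = \sum_A w_A (\int_A g)^2], and the problem becomes one about
    choosing weights for vectors in a finite-dimensional l_1 space.

    If the weights were independent positive 1/2-stable variables with Laplace
    transform [exp (- sqrt s)], then [Y = \sum_A w_A a_A^2] with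
    [\sum_A `|a_A| = 1] would be 1/2-stable as well: Chernoff gives
    [P (Y < 1 / (8 ln n)) <= n^-2], which survives the union bound over the pairs,
    while [E (Y^(1/4))] is bounded.  Here the stable law is replaced by a finite
    sum of scaled Bernoulli variables whose Laplace exponent is at least [sqrt s]
    on the finitely many values of [s] that matter, and a good outcome is found
    by the method of conditional expectations. *)

Local Open Scope ring_scope.

(** * Choosing one outcome of finitely many Bernoulli variables *)

(** One step of the conditional expectations: [l0] and [l1] are the values reached in the two
    branches, and [b] is the cost of setting the variable to 1. If both branches exceeded the
    target, so would their average with weights [1 - p] and [p]. The case [p = 0] is separate
    because the second branch then carries no weight. *)
Lemma two_point_average (R : realFieldType) (p a0 a1 d b l0 l1 s : R) :
  0 <= p -> p <= 1 -> l0 <= a0 + d -> l1 <= a1 + d ->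
  (1 - p) * a0 + p * a1 <= s ->
  l0 <= s + (b * p + d) \/ l1 + b <= s + (b * p + d).
Proof.
move=> p0 p1 h0 h1 hs.
have [|h] := leP l0 (s + (b * p + d)); first by left.
right; have q0 : 0 <= 1 - p by rewrite subr_ge0.
have [pz|pn0] := eqVneq p 0; first by move: hs h; rewrite pz; lra.
have pp : 0 < p by rewrite lt0r pn0.
rewrite -(ler_pM2l pp).
have := ler_wpM2l q0 (ltW h); have := ler_wpM2l q0 h0; have := ler_wpM2l p0 h1.
lra.
Qed.

(* Independent Bernoulli variables of parameters [p i] have an outcome [B] at which
   the left-hand side is at most its expectation, which is bounded by the
   right-hand side since [1 - p + p exp (-c) <= exp (- p (1 - exp (-c)))]. *)
Lemma exists_expectation_le (R : realType) (I J : finType) (p : I -> R)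
    (c : J -> I -> R) (beta : I -> R) (alpha : J -> R) :
  (forall i, 0 <= p i <= 1) -> (forall j, 0 <= alpha j) ->
  exists B : I -> bool,
    \sum_j alpha j * expR (- \sum_(i | B i) c j i) + \sum_(i | B i) beta i <=
    \sum_j alpha j * expR (- \sum_i p i * (1 - expR (- c j i))) +
    \sum_i beta i * p i.
Proof.
move=> p01.
(* [al] varies in the induction because setting the variable [x] to 1 multiplies each [al j] by
   [expR (- c j x)]. *)
have step (s : seq I) : uniq s -> forall al : J -> R, (forall j, 0 <= al j) ->
    exists B : I -> bool,
    \sum_j al j * expR (- \sum_(i <- s | B i) c j i) +
      \sum_(i <- s | B i) beta i <=
    \sum_j al j * expR (- \sum_(i <- s) p i * (1 - expR (- c j i))) +
    \sum_(i <- s) beta i * p i.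
  elim: s => [_ al _|x s IH /= /andP[xs us] al al0].
    exists xpredT; rewrite !big_nil lerD2r.
    by apply: ler_sum => j _; rewrite !big_nil.
  have [B0 HB0] := IH us al al0.
  have al1 j : 0 <= al j * expR (- c j x) by rewrite mulr_ge0 ?expR_ge0.
  have [B1 HB1] := IH us (fun j => al j * expR (- c j x)) al1.
  have /andP[p0 p1] := p01 x.
  rewrite !big_cons.
  under [X in exists B, _ <= X + _]eq_bigr do
    rewrite big_cons opprD expRD mulrA.
  set E := fun j => expR (- \sum_(i <- s) p i * (1 - expR (- c j i))) in HB0 HB1 *.
  set D := \sum_(i <- s) _ in HB0 HB1 *.
  have avg : (1 - p x) * (\sum_j al j * E j) +
      p x * (\sum_j al j * expR (- c j x) * E j) <=
      \sum_j al j * expR (- (p x * (1 - expR (- c j x)))) * E j.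
    rewrite !mulr_sumr -big_split /=; apply: ler_sum => j _.
    have := expR_ge1Dx (- (p x * (1 - expR (- c j x)))).
    have : 0 <= al j * E j by rewrite mulr_ge0 ?expR_ge0.
    move: (expR (- c j x)) (expR _) (al j) (E j) => u w a e ae /(ler_wpM2l ae).
    lra.
  pose upd B b := fun i => if i == x then b else B i : bool.
  have updE B b (F : I -> R) : \sum_(i <- s | upd B b i) F i = \sum_(i <- s | B i) F i.
    rewrite big_seq_cond [RHS]big_seq_cond; apply: eq_bigl => i /=.
    rewrite /upd; case: eqP => [->|//]; by rewrite (negbTE xs).
  have [h|h] := two_point_average _ _ _ _ _ (beta x) _ _ _ p0 p1 HB0 HB1 avg.
    exists (upd B0 false).
    under eq_bigr do rewrite big_cons {1}/upd eqxx updE.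
    by rewrite big_cons {1}/upd eqxx updE.
  exists (upd B1 true).
  under eq_bigr do rewrite big_cons {1}/upd eqxx updE opprD expRD mulrA.
  by rewrite big_cons {1}/upd eqxx updE [beta x + \sum_(i <- s | _) _]addrC addrA.
move=> alpha0; have [B HB] := step _ (index_enum_uniq I) _ alpha0.
by exists B.
Qed.

(** * Fourth roots and geometric sums *)

Lemma sqrtr_sum_le (R : rcfType) (I : Type) (s : seq I) (P : pred I) (z : I -> R) :
  (forall i, 0 <= z i) ->
  Num.sqrt (\sum_(i <- s | P i) z i) <= \sum_(i <- s | P i) Num.sqrt (z i).
Proof.
move=> z0; apply: (big_ind2 (fun x y => Num.sqrt x <= y)).
- by rewrite sqrtr0.
- move=> x1 x2 y1 y2 h1 h2; apply: le_trans (lerD h1 h2).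
  (* The invariant does not record the sign of the partial sums; a negative one has root 0 by
     convention. *)
  have [x0|/ltW x0] := leP 0 x1; last first.
    rewrite (ler0_sqrtr x0) add0r; apply: ler_wsqrtr; lra.
  have [x0'|/ltW x0'] := leP 0 y1; last first.
    rewrite (ler0_sqrtr x0') addr0; apply: ler_wsqrtr; lra.
  rewrite -[leRHS]ger0_norm ?addr_ge0 ?sqrtr_ge0// -sqrtr_sqr ler_wsqrtr//.
  have := mulr_ge0 (sqrtr_ge0 x1) (sqrtr_ge0 y1).
  by rewrite sqrrD !sqr_sqrtr// => ?; lra.
- by move=> i _.
Qed.

(* The terms with [z i <= 4 root4 (z i)] are handled by the tangent line of the
   fourth root at 1, the others by subadditivity. *)
Lemma root4_sum_le (R : rcfType) (I : Type) (s : seq I) (P : pred I) (z : I -> R) :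
  (forall i, 0 <= z i) ->
  Num.sqrt (Num.sqrt (\sum_(i <- s | P i) z i)) <=
  3 / 4 + \sum_(i <- s | P i) Num.min (z i / 4) (Num.sqrt (Num.sqrt (z i))).
Proof.
move=> z0; pose small i := z i / 4 <= Num.sqrt (Num.sqrt (z i)).
rewrite [X in Num.sqrt X](_ : _ =
    Num.sqrt (\sum_(i <- s | P i && small i) z i + \sum_(i <- s | P i && ~~ small i) z i));
  last by rewrite -bigID.
set A := \sum_(i <- s | P i && small i) z i.
set C := \sum_(i <- s | P i && ~~ small i) z i.
have sD (x y : R) : 0 <= x -> 0 <= y -> Num.sqrt (x + y) <= Num.sqrt x + Num.sqrt y.
  move=> x0 y0; have := @sqrtr_sum_le R bool [:: true; false] xpredT (fun b => if b then x else y).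
  by rewrite !big_cons !big_nil !addr0; apply; case.
have A0 : 0 <= A by apply: sumr_ge0.
have C0 : 0 <= C by apply: sumr_ge0.
apply: (@le_trans _ _ (Num.sqrt (Num.sqrt A) + Num.sqrt (Num.sqrt C))).
  by apply: le_trans (sD _ _ (sqrtr_ge0 _) (sqrtr_ge0 _)); rewrite ler_wsqrtr ?sD.
rewrite (bigID small) /= addrA lerD//.
  apply: (@le_trans _ _ (3 / 4 + A / 4)).
    rewrite -{2}(sqr_sqrtr A0) -{2}(sqr_sqrtr (sqrtr_ge0 A)).
    move: (Num.sqrt (Num.sqrt A)) => u.
    (* The tangent line bound comes from [u^4 - 4u + 3 = (u - 1)^2 ((u + 1)^2 + 2)]. *)
    have := mulr_ge0 (sqr_ge0 (u - 1)) (addr_ge0 (sqr_ge0 (u + 1)) (ler0n _ 2)).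
    rewrite !expr2; lra.
  rewrite lerD2l mulr_suml ler_sum// => i /andP[_ /min_idPl ->].
  by [].
apply: le_trans (ler_wsqrtr (sqrtr_sum_le _ _ _ _ z z0)) _.
apply: le_trans (sqrtr_sum_le _ _ _ _ _ (fun i => sqrtr_ge0 (z i))) _.
by apply: ler_sum => i /andP[_]; rewrite /small -ltNge => /ltW/min_idPr ->.
Qed.

(* Comparison with the telescoping potential [h v = v^2/12] for [v <= 2] and
   [h v = 2 - 2/v] beyond. *)
Lemma sum_min_geometric_le (R : realFieldType) (v : R) (m : nat) : 0 < v ->
  \sum_(i < m) Num.min ((v * 2 ^+ i) ^+ 2 / 4) (v * 2 ^+ i)^-1 <= 2.
Proof.
move=> v0; pose h (u : R) := if u <= 2 then u ^+ 2 / 12 else 2 - 2 / u.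
have step u : 0 < u -> h u + Num.min (u ^+ 2 / 4) u^-1 <= h (u * 2).
  move=> u0; rewrite /h.
  have uu : u * u^-1 = 1 by rewrite divff ?gt_eqF.
  have iu : 0 < u^-1 by rewrite invr_gt0.
  have mn1 : Num.min (u ^+ 2 / 4) u^-1 <= u ^+ 2 / 4 by rewrite ge_min lexx.
  have mn2 : Num.min (u ^+ 2 / 4) u^-1 <= u^-1 by rewrite ge_min lexx orbT.
  have i2u : 2 / (u * 2) = u^-1 by rewrite invfM mulrCA divff// mulr1.
  rewrite i2u; move: mn1 mn2; rewrite !expr2.
  set mn := Num.min _ _ => mn1 mn2.
  (* For [u <= 1], [u^2/12 + u^2/4 = (2u)^2/12]; for [u > 2], [2 - 2/u + 1/u = 2 - 2/(2u)]. Only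
     [1 < u <= 2] is left after [lra]. *)
  case: (leP u 2) => hu; case: (leP (u * 2) 2) => hu2; try lra.
  have : 0 <= u * u * ((2 - u) * (u - 1)) by rewrite !mulr_ge0 //; lra.
  have iu1 : u^-1 <= 1 by rewrite invf_le1//; lra.
  have : 0 <= (1 - u^-1) * (2 - u) by rewrite !mulr_ge0 //; lra.
  have : 0 <= (2 - u) * (u - 1) by rewrite !mulr_ge0 //; lra.
  nra.
have tel : \sum_(i < m) Num.min ((v * 2 ^+ i) ^+ 2 / 4) (v * 2 ^+ i)^-1 <= h (v * 2 ^+ m).
  elim: m => [|m IH].
    rewrite big_ord0 expr0 mulr1 /h; case: (leP v 2) => hv.
      by rewrite divr_ge0 ?sqr_ge0.
    by rewrite subr_ge0 ler_pdivrMr//; lra.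
  rewrite big_ord_recr /= [in leRHS]exprSr mulrA.
  by apply: le_trans (step _ _); rewrite ?lerD2r// mulr_gt0 ?exprn_gt0.
have w0 : 0 < v * 2 ^+ m by rewrite mulr_gt0 ?exprn_gt0.
apply: le_trans tel _; rewrite /h; move: (v * _) w0 => w w0; case: (leP w 2) => hw.
  by rewrite expr2; nra.
by rewrite gerBl divr_ge0// ltW.
Qed.

(** * A discrete 1/2-stable law *)

(** Jump sizes: the ratio 16 makes their square roots grow by the factor 4 and their fourth roots by
    the factor 2. *)
Definition level (R : realType) (P i : nat) : R := 16 ^+ i / 16 ^+ P.

Lemma level_gt0 (R : realType) (P i : nat) : 0 < level R P i.
Proof. by rewrite divr_gt0 ?exprn_gt0. Qed.

(** Bounds the expected truncated fourth roots from one coordinate, with [2 * 4 ^+ P] copies of each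
    level [i], each present with probability [4^-i]. For [y = v * 2 ^+ i] the scaled jump is [y^4]
    and [4^P / 4^i = |b| / y^2], so a term is [2 |b| min (y^2/4, 1/y)] and the geometric bound
    applies. *)
Lemma sum_level_min_le (R : realType) (P M : nat) (b : R) :
  \sum_(i < M) (2 * 4 ^+ P) * ((4 ^+ i)^-1 *
    Num.min (level R P i * b ^+ 2 / 4) (Num.sqrt (Num.sqrt (level R P i * b ^+ 2))))
  <= 4 * `|b|.
Proof.
have [->|b0] := eqVneq b 0.
  rewrite big1 ?normr0 ?mulr0// => i _.
  by rewrite expr0n mulr0 mul0r !sqrtr0 minxx !mulr0.
set t := Num.sqrt `|b|; have t0 : 0 < t by rewrite sqrtr_gt0 normr_gt0.
have tb : t ^+ 2 = `|b| by rewrite sqr_sqrtr.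
pose v := t / 2 ^+ P.
have v0 : 0 < v by rewrite divr_gt0 ?exprn_gt0.
have pow4 (i : nat) : (4 : R) ^+ i = (2 ^+ i) ^+ 2
  by rewrite -exprM mulnC exprM -(natrX R 2 2).
have pow16 (i : nat) : (16 : R) ^+ i = (2 ^+ i) ^+ 4
  by rewrite -exprM mulnC exprM -(natrX R 2 4).
apply: (@le_trans _ _
  (2 * `|b| * \sum_(i < M) Num.min ((v * 2 ^+ i) ^+ 2 / 4) (v * 2 ^+ i)^-1)); last first.
  have b20 : 0 <= 2 * `|b| by rewrite mulr_ge0.
  by have := ler_wpM2l b20 (sum_min_geometric_le R v M v0); lra.
rewrite mulr_sumr ler_sum// => i _; rewrite le_eqVlt; apply/orP; left; apply/eqP.
have a0 : (2 : R) ^+ P != 0 by rewrite expf_neq0.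
have a1 : (2 : R) ^+ i != 0 by rewrite expf_neq0.
have tn0 : t != 0 by rewrite gt_eqF.
have vi0 : 0 < v * 2 ^+ i by rewrite mulr_gt0 ?exprn_gt0.
have zE : level R P i * b ^+ 2 = (v * 2 ^+ i) ^+ 4.
  rewrite /level -real_normK ?num_real// -tb /v !pow16.
  by field.
have rE : Num.sqrt (Num.sqrt (level R P i * b ^+ 2)) = v * 2 ^+ i.
  rewrite zE (_ : (v * 2 ^+ i) ^+ 4 = ((v * 2 ^+ i) ^+ 2) ^+ 2); last by rewrite -exprM.
  by rewrite !sqrtr_sqr ger0_norm ?sqr_ge0// sqrtr_sqr gtr0_norm.
rewrite rE zE mulrA !minr_pMr.
- rewrite -tb !pow4; congr Num.min; rewrite /v; field; by rewrite ?a0 ?a1 ?tn0.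
- by rewrite mulr_ge0.
- by rewrite !mulr_ge0// ?invr_ge0 exprn_ge0.
Qed.

(** The sum is the Laplace exponent at [r^2]. The numbers [y i = r 4^i / 4^P] grow by the factor 4,
    start below 1 and reach 1 by [i = M]. The two terms around the crossing, [y m < 1 <= y m.+1],
    already add up to at least [r]. *)
Lemma le_sum_level_expR (R : realType) (P M : nat) (r : R) :
  0 < r < 4 ^+ P -> 4 ^+ P <= r * 4 ^+ M ->
  r <= \sum_(i < M.+1) (2 * 4 ^+ P) *
         ((4 ^+ i)^-1 * (1 - expR (- (level R P i * r ^+ 2)))).
Proof.
move=> /andP[r0 rP] rM.
have exM : exists m, 4 ^+ P <= r * 4 ^+ m by exists M.
have [m hm minm] := ex_minnP exM.
have pow16 (i : nat) : (16 : R) ^+ i = (4 ^+ i) ^+ 2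
  by rewrite -exprM mulnC exprM -(natrX R 4 2).
have P0 : (0 : R) < 4 ^+ P by rewrite exprn_gt0.
case: m hm minm => [|m hm minm]; first by rewrite expr0 mulr1 leNgt rP.
have hm' : r * 4 ^+ m < 4 ^+ P.
  by rewrite ltNge; apply/negP => /minm; rewrite ltnn.
have mM : (m.+1 <= M)%N by exact: minm.
pose y (i : nat) : R := r * 4 ^+ i / 4 ^+ P.
have y0 i : 0 < y i by rewrite !mulr_gt0 ?invr_gt0 ?exprn_gt0.
(* [1 - exp (-u) >= u / (1 + u)] with [u = (y i)^2]. *)
have term (i : nat) : 2 * r * (y i / (1 + y i ^+ 2)) <= (2 * 4 ^+ P) *
         ((4 ^+ i)^-1 * (1 - expR (- (level R P i * r ^+ 2)))).
  have i0 : (4 : R) ^+ i != 0 by rewrite expf_neq0.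
  have uE : level R P i * r ^+ 2 = y i ^+ 2.
    rewrite /level /y !pow16; field; by rewrite gt_eqF.
  rewrite uE.
  have -> : 2 * 4 ^+ P * ((4 ^+ i)^-1 * (1 - expR (- y i ^+ 2))) =
     2 * r * ((y i)^-1 * (1 - expR (- y i ^+ 2))).
     by rewrite /y; field; rewrite i0 !gt_eqF.
  have d0 : 0 < 1 + y i ^+ 2 by have := sqr_ge0 (y i); lra.
  have -> : y i / (1 + y i ^+ 2) = (y i)^-1 * (1 - (1 + y i ^+ 2)^-1).
    by field; rewrite !gt_eqF.
  rewrite ler_pM2l ?mulr_gt0// ler_pM2l ?invr_gt0// lerD2l lerN2 expRN.
  by rewrite lef_pV2 ?posrE ?expR_gt0 ?expR_ge1Dx.
have nn (i : nat) : 0 <= 2 * 4 ^+ P *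
         ((4 ^+ i)^-1 * (1 - expR (- (level R P i * r ^+ 2)))).
  by apply: le_trans (term i); rewrite !mulr_ge0 ?invr_ge0 ?addr_ge0 ?sqr_ge0 ?ltW.
have im : (m < M.+1)%N by rewrite ltnS ltnW.
have im1 : (m.+1 < M.+1)%N by rewrite ltnS.
rewrite (bigD1 (Ordinal im)) //= (bigD1 (Ordinal im1)) /=; last first.
  by rewrite -val_eqE /= eqn_leq ltnn.
rewrite addrA -[leLHS]addr0 lerD//; last by apply: sumr_ge0.
apply: le_trans (lerD (term m) (term m.+1)).
have yS : y m.+1 = 4 * y m by rewrite /y exprS; ring.
have y1 : 1 <= y m.+1 by rewrite ler_pdivlMr // mul1r.
have y2 : y m < 1 by rewrite ltr_pdivrMr // mul1r.
rewrite -mulrDr -[leLHS]mulr1 -[2 * r]mulrC -mulrA ler_wpM2l ?ltW//.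
rewrite yS in y1 *; move: (y m) y1 y2 => w y1 y2.
have d1 : 0 < 1 + w ^+ 2 by have := sqr_ge0 w; lra.
have d2 : 0 < 1 + (4 * w) ^+ 2 by have := sqr_ge0 (4 * w); lra.
(* Both fractions are at least 4/17, the value of [y / (1 + y^2)] at 1/4 and 4; one of them is at
   least 2/5, the value at 1/2 and 2; and [4/17 + 2/5 > 1/2]. *)
have b1 : 4 / 17 <= w / (1 + w ^+ 2).
  rewrite ler_pdivlMr// expr2; have : 0 <= (4 * w - 1) * (4 - w) by rewrite mulr_ge0; lra.
  lra.
have b2 : 4 / 17 <= 4 * w / (1 + (4 * w) ^+ 2).
  rewrite ler_pdivlMr// expr2.
  have : 0 <= (4 * w - 1) * (1 - w) by rewrite mulr_ge0; lra.
  lra.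
have [w2|w2] := leP w (1 / 2).
  have : 2 / 5 <= 4 * w / (1 + (4 * w) ^+ 2).
    rewrite ler_pdivlMr// expr2.
    have : 0 <= (4 * w - 1) * (1 - 2 * w) by rewrite mulr_ge0; lra.
    lra.
  lra.
have : 2 / 5 <= w / (1 + w ^+ 2).
  rewrite ler_pdivlMr// expr2.
  have : 0 <= (2 * w - 1) * (2 - w) by rewrite mulr_ge0; lra.
  lra.
lra.
Qed.

(** * Weights from a good outcome *)

Lemma exists_level_range (R : realType) (I : finType) (r : I -> R) :
  (forall i, 0 <= r i) ->
  exists P M : nat, forall i, r i < 4 ^+ P /\ (0 < r i -> 4 ^+ P <= r i * 4 ^+ M).
Proof.
have lt4 (i : nat) : (i%:R : R) < 4 ^+ i by rewrite -natrX ltr_nat ltn_expl.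
have bnd (g : I -> R) : (forall i, 0 <= g i) -> exists m : nat, forall i, g i < 4 ^+ m.
  move=> g0; exists (Num.bound (\sum_i g i)) => i.
  apply: le_lt_trans (lt_trans (archi_boundP _) (lt4 _)); last exact: sumr_ge0.
  by rewrite (bigD1 i)//= lerDl sumr_ge0.
move=> r0; have [P hP] := bnd _ r0.
have q0 i : 0 <= 4 ^+ P / r i by rewrite divr_ge0 ?exprn_ge0.
have [M hM] := bnd _ q0.
exists P, M => i; split => // ri.
by rewrite mulrC -ler_pdivrMr// ltW.
Qed.

(** One potential yields both bounds: with [Y_q] the weighted sum of squares, it is the sum over [q]
    of [exp (2l - s Y_q)] plus [1 / (10 |Q|)] times the sum of the truncated fourth roots. Its
    expectation is at most [1/2 + 4/10], and both parts are nonnegative, so at a good outcome each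
    is at most 9/10. *)
Lemma exists_weights (R : realType) (Q K : finType) (a : Q -> K -> R) (l : R) :
  0 < l -> (forall q, \sum_k `|a q k| = 1) ->
  #|Q|%:R * expR (- (2 * l)) <= 1 / 2 ->
  exists w : K -> R,
    [/\ forall k, 0 <= w k,
        forall q, 1 / (8 * l) <= \sum_k w k * a q k ^+ 2
      & \sum_q Num.sqrt (Num.sqrt (\sum_k w k * a q k ^+ 2)) <= 10 * #|Q|%:R].
Proof.
move=> l0 a1 Ql.
have [Q0|Qpos] := leqP #|Q| 0.
  exists (fun=> 0); split => // [q|].
    by move: Q0; rewrite leqn0 (cardD1 q).
  by rewrite big1 ?mulr_ge0// => q _; move: Q0; rewrite leqn0 (cardD1 q).
have QR : (0 : R) < #|Q|%:R by rewrite ltr0n.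
(* [4 * l] is the square root of the parameter [s] below. *)
have r0 (qk : Q * K) : 0 <= 4 * l * `|a qk.1 qk.2| by rewrite !mulr_ge0// ltW.
have [P [M hPM]] := exists_level_range R _ _ r0.
(* For each coordinate [k] and level [i] take [N] Bernoulli variables of parameter
   [p = 4^-i], so that [N p = 2 / sqrt (level P i)], the discrete analogue of the
   Levy measure of the 1/2-stable law. *)
pose N := (2 * 4 ^ P)%N.
have NE : N%:R = 2 * 4 ^+ P :> R by rewrite natrM natrX.
pose I := (K * ('I_M.+1 * 'I_N))%type.
pose x (e : I) : R := level R P e.2.1.
pose p (e : I) : R := (4 ^+ e.2.1)^-1.
(* Minimises [exp (s t - sqrt s)] for [t = 1 / (8 l)]. *)
pose s := 16 * l ^+ 2.
pose c (q : Q) (e : I) : R := s * (x e * a q e.1 ^+ 2).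
pose g (z : R) := Num.min (z / 4) (Num.sqrt (Num.sqrt z)).
pose eps : R := (10 * #|Q|%:R)^-1.
have eps0 : 0 < eps by rewrite invr_gt0 mulr_gt0.
pose beta (e : I) : R := \sum_q eps * g (x e * a q e.1 ^+ 2).
have p01 e : 0 <= p e <= 1.
  by rewrite /p invr_ge0 exprn_ge0//= invf_le1 ?exprn_gt0// exprn_ege1// ler1n.
have [B] := exists_expectation_le R I Q p c beta (fun=> expR (2 * l)) p01
  (fun=> expR_ge0 _).
have x0 e : 0 < x e := level_gt0 _ _ _.
have xa0 q e : 0 <= x e * a q e.1 ^+ 2 by rewrite mulr_ge0 ?sqr_ge0 ?ltW.
have sumI (F : K -> 'I_M.+1 -> R) :
    \sum_(e : I) F e.1 e.2.1 = \sum_k \sum_i (2 * 4 ^+ P) * F k i.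
  rewrite -(pair_bigA _ (fun k ir => F k ir.1))/=; apply: eq_bigr => k _.
  rewrite -(pair_bigA _ (fun i (_ : 'I_N) => F k i))/=; apply: eq_bigr => i _.
  by rewrite sumr_const card_ord -NE mulr_natl.
(* Stability: the exponents of the coordinates are at least [sqrt s |a q k|], and these add up to
   [sqrt s]. *)
have lower q : 4 * l <= \sum_e p e * (1 - expR (- c q e)).
  have -> : 4 * l = \sum_k 4 * l * `|a q k| by rewrite -mulr_sumr a1 mulr1.
  rewrite [leRHS](sumI (fun k (i : 'I_M.+1) =>
    (4 ^+ i)^-1 * (1 - expR (- (s * (level R P i * a q k ^+ 2)))))).
  apply: ler_sum => k _; have [h1 h2] := hPM (q, k); move: h1 h2 => /= h1 h2.
  have [z|nz] := eqVneq (a q k) 0.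
    rewrite z normr0 mulr0 sumr_ge0// => i _.
    by rewrite expr0n/= !mulr0 oppr0 expR0 subrr !mulr0.
  have rk0 : 0 < 4 * l * `|a q k| by rewrite !mulr_gt0 ?normr_gt0.
  have := @le_sum_level_expR R P M (4 * l * `|a q k|).
  rewrite rk0 h1 => /(_ isT (h2 rk0)) /le_trans; apply.
  rewrite le_eqVlt; apply/orP; left; apply/eqP; apply: eq_bigr => i _.
  congr (_ * (_ * (1 - expR (- _)))).
  by rewrite !exprMn real_normK ?num_real// /s; ring.
have upper : \sum_e beta e * p e <= 4 / 10.
  rewrite /beta; under eq_bigr do rewrite mulr_suml.
  rewrite exchange_big /=.
  apply: (@le_trans _ _ (\sum_(q : Q) eps * 4)); last first.
    rewrite sumr_const -mulr_natr /eps le_eqVlt; apply/orP; left; apply/eqP.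
    by field; rewrite gt_eqF.
  apply: ler_sum => q _.
  under eq_bigr do rewrite -mulrA [g _ * _]mulrC.
  rewrite -mulr_sumr ler_wpM2l ?(ltW eps0)//.
  rewrite [leLHS](sumI (fun k (i : 'I_M.+1) => (4 ^+ i)^-1 * g (level R P i * a q k ^+ 2))).
  rewrite [leRHS](_ : _ = \sum_k 4 * `|a q k|); last by rewrite -mulr_sumr a1 mulr1.
  by apply: ler_sum => k _; exact: (sum_level_min_le R P M.+1 (a q k)).
set S1 := \sum_(j : Q) _; set S2 := \sum_(i | B i) _; set S3 := \sum_(j : Q) _.
have S3le : S3 <= 1 / 2.
  apply: le_trans Ql; rewrite mulr_natl -sumr_const; apply: ler_sum => q _.
  by rewrite -expRD ler_expR; have := lower q; lra.
move=> hB.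
have S12 : S1 + S2 <= 9 / 10 by apply: le_trans hB _; lra.
have S10 : 0 <= S1 by apply: sumr_ge0 => q _; rewrite mulr_ge0 ?expR_ge0.
have g0 z : 0 <= z -> 0 <= g z.
  by move=> z0; rewrite /g le_min divr_ge0// sqrtr_ge0.
have S20 : 0 <= S2.
  apply: sumr_ge0 => e _; apply: sumr_ge0 => q _.
  by rewrite mulr_ge0 ?(ltW eps0)// g0.
exists (fun k => \sum_(u : 'I_M.+1 * 'I_N | B (k, u)) x (k, u)).
have YE q : \sum_k (\sum_(u : 'I_M.+1 * 'I_N | B (k, u)) x (k, u)) * a q k ^+ 2 =
    \sum_(e | B e) x e * a q e.1 ^+ 2.
  under eq_bigr do rewrite mulr_suml.
  by rewrite pair_big_dep /=; apply: eq_big => [[k u]|[k u] _].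
split=> [k|q|].
- by apply: sumr_ge0 => u _; exact: ltW.
(* Since [s / (8l) = 2l], a single failing [q] would contribute at least 1 to [S1]. *)
- rewrite YE leNgt; apply/negP => hY.
  have s1 : S1 < 1 by lra.
  have : expR (2 * l) * expR (- \sum_(e | B e) c q e) <= S1.
    rewrite /S1 (bigD1 q)//= lerDl; apply: sumr_ge0 => j _.
    by rewrite mulr_ge0 ?expR_ge0.
  rewrite -expRD leNgt => /negP; apply; apply: lt_le_trans s1 _.
  rewrite -[leLHS]expR0 ler_expR subr_ge0 /c -mulr_sumr.
  have s0 : 0 <= s by rewrite /s mulr_ge0// sqr_ge0.
  apply: le_trans (ler_wpM2l s0 (ltW hY)) _.
  by rewrite /s le_eqVlt; apply/orP; left; apply/eqP; field; rewrite gt_eqF.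
(* On average over [q] the bound is [3/4 + 9 <= 10]. *)
- apply: (@le_trans _ _ (\sum_(q : Q) (3 / 4 + \sum_(e | B e) g (x e * a q e.1 ^+ 2)))).
    by apply: ler_sum => q _; rewrite YE; exact: root4_sum_le.
  rewrite big_split /= sumr_const exchange_big /=.
  have -> : \sum_(e | B e) \sum_(q : Q) g (x e * a q e.1 ^+ 2) = S2 / eps.
    rewrite /S2 /beta mulr_suml; apply: eq_bigr => e _.
    by rewrite -mulr_sumr mulrAC divff ?mul1r// gt_eqF.
  rewrite /eps invrK -mulr_natr.
  have : S2 * (10 * #|Q|%:R) <= (9 / 10) * (10 * #|Q|%:R).
    by rewrite ler_wpM2r// ?mulr_ge0//; lra.
  lra.
Qed.

(** * The operators *)

Section integration_over_fibers.
Local Open Scope classical_set_scope.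

Lemma ge0_integral_fibers d (T : measurableType d) (R : realType)
    (mu : {measure set T -> \bar R}) (K : finType) (cell : T -> K)
    (mcell : forall k, measurable (cell @^-1` [set k])) (g : T -> \bar R) :
  measurable_fun setT g -> (forall x, 0 <= g x)%E ->
  (\int[mu]_x g x = \sum_k \int[mu]_(x in cell @^-1` [set k]) g x)%E.
Proof.
move=> mg g0.
have TE : setT = \big[setU/set0]_(k <- enum K) (cell @^-1` [set k]).
  rewrite -bigcup_seq; apply/seteqP; split=> // x _.
  by exists (cell x) => //=; rewrite mem_enum.
rewrite [in LHS]TE ge0_integral_bigsetU -?TE ?enum_uniq//.
  by rewrite big_enum.
exact: trivIset_preimage1.
Qed.

Section Lspace_facts.
Context d (T : measurableType d) (R : realType) (mu : {measure set T -> \bar R}).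

(** Operations on classes pick a new representative, so the pointwise formula survives only almost
    everywhere. *)
Lemma Lspace_linear_ae (p : \bar R) (p1 : (1 <= p)%E) (a : R) (f g : LspaceType mu p1) :
  ((a *: f + g : LspaceType mu p1) : T -> R) = (fun x => a * f x + g x) %[ae mu].
Proof.
have -> : a *: f + g = Lclass (a *: Lrepr f + Lrepr g).
  by rewrite -LclassD -LclassZ !LreprK.
exact: LclassK.
Qed.

Let L1 := LspaceType mu (@lexx _ _ 1%E).

Lemma L1_integrable (f : L1) : mu.-integrable setT (EFin \o (f : T -> R)).
Proof. by apply/Lfun1_integrable; exact: mem_Lspace. Qed.

Lemma L1_normE (f : L1) : `|f| = \int[mu]_x `|f x|.
Proof. by rewrite Lnorm_LspaceE Lnorm1. Qed.

Lemma L1_Rintegral_linear (A : set T) (mA : measurable A) (a : R) (f g : L1) :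
  \int[mu]_(x in A) (a *: f + g : L1) x =
  a * \int[mu]_(x in A) f x + \int[mu]_(x in A) g x.
Proof.
have fi (h : L1) : mu.-integrable A (EFin \o (h : T -> R)).
  by apply: integrableS (L1_integrable h).
have mh (h : L1) : measurable_fun A (EFin \o (h : T -> R)).
  by case/integrableP: (fi h).
rewrite -RintegralZl// -RintegralD//; last first.
  rewrite (_ : EFin \o _ = (fun x => a%:E * (EFin \o (f : T -> R)) x)%E)//.
  exact: integrableZl.
congr fine; apply: ae_eq_integral => //.
- exact: mh.
- apply/measurable_EFinP; apply: measurable_funD.
    by apply: measurable_funM => //; exact/measurable_EFinP.
  exact/measurable_EFinP.
- have := Lspace_linear_ae _ _ a f g; apply: filterS => x h _.
  by rewrite /= h.
Qed.

Lemma L1_norm_Rintegral_le (A : set T) (mA : measurable A) (f : L1) :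
  `|\int[mu]_(x in A) f x| <= `|f|.
Proof.
apply: le_trans (le_normr_Rintegral mA _) _.
  exact: integrableS (L1_integrable f).
rewrite L1_normE; apply: fine_le.
- have /integrable_abse : mu.-integrable A (EFin \o (f : T -> R)).
    exact: integrableS (L1_integrable f).
  exact: integrable_fin_num.
- have /integrable_abse := L1_integrable f.
  exact: integrable_fin_num.
- apply: ge0_subset_integral => //.
  by apply/measurable_EFinP; exact: measurableT_comp.
Qed.

Lemma sum_fibers_sqr_norm (K : finType) (cell : T -> K)
    (mcell : forall k, measurable (cell @^-1` [set k]))
    (muT : (mu setT < +oo)%E) (c : K -> R)
    (f : LfunType mu (lee1n 2 : (1 <= 2%:R%:E)%E)) :
  (f : T -> R) = c \o cell ->
  `|Lclass f| ^+ 2 = \sum_k c k ^+ 2 * fine (mu (cell @^-1` [set k])).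
Proof.
move=> fE.
rewrite (_ : `|Lclass f| = fine ('N[mu]_(2%:R%:E)[EFin \o f])%E); last first.
  exact: normL_class.
have finA k : mu (cell @^-1` [set k]) \is a fin_num.
  rewrite ge0_fin_numE//; apply: le_lt_trans muT.
  by apply: le_measure => //; rewrite inE.
apply: EFin_inj; rewrite -powR_mulrn ?fine_ge0 ?Lnorm_ge0// -poweR_EFin.
rewrite finite_norm_fine poweR_Lnorm ?pnatr_eq0//.
rewrite (ge0_integral_fibers _ _ _ mu K cell) //.
- rewrite -sumEFin; apply: eq_bigr => k _.
  rewrite (eq_integral (cst (c k ^+ 2)%:E)).
    by rewrite integral_cst// [in RHS]EFinM fineK.
  move=> x; rewrite inE /= => xk.
  rewrite fE /= xk powR_mulrn ?normr_ge0//.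
  by rewrite real_normK ?num_real.
- apply: (@measurableT_comp _ _ _ _ _ _ (fun x : \bar R => x `^ 2)%E) => //.
    exact: measurable_poweR.
  by apply: measurableT_comp => //; apply/measurable_EFinP.
- by move=> x; exact: poweR_ge0.
Qed.

End Lspace_facts.

End integration_over_fibers.

Section fibers.
Local Open Scope classical_set_scope.
Context d (T : measurableType d) (R : realType) (mu : {measure set T -> \bar R}).
Context (K : finType) (cell : T -> K) (mcell : forall k, measurable (cell @^-1` [set k])).

Let L1 := LspaceType mu (@lexx _ _ 1%E).
Let L2 := LspaceType mu (lee1n 2 : (1 <= 2%:R%:E :> \bar R)%E).

(** On a cell of constant sign, integration commutes with the absolute value. The sign is required
    of [h] because the chosen representative of [g] is controlled only almost everywhere. *)
Lemma sum_norm_Rintegral_fibers (g : L1) (h : T -> R) :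
  mu.-integrable setT (EFin \o h) -> (g : T -> R) = h %[ae mu] ->
  (forall k, (forall x, cell x = k -> 0 <= h x) \/
             (forall x, cell x = k -> h x <= 0)) ->
  \sum_k `|\int[mu]_(x in cell @^-1` [set k]) g x| = `|g|.
Proof.
move=> ih gh sgn.
have mh : measurable_fun setT h by case/integrableP: ih => /measurable_EFinP.
have mg : measurable_fun setT (g : T -> R) by exact: measurable_Lspace.
have iAh k : mu.-integrable (cell @^-1` [set k]) (EFin \o h).
  by apply: integrableS ih.
have fin k : (\int[mu]_(x in cell @^-1` [set k]) `|h x|%:E)%E \is a fin_num.
  have /integrable_abse := iAh k; exact: integrable_fin_num.
have -> : `|g| = \int[mu]_x `|h x|.
  rewrite L1_normE; congr fine; apply: ae_eq_integral => //.
  - by apply/measurable_EFinP; exact: measurableT_comp.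
  - by apply/measurable_EFinP; exact: measurableT_comp.
  - by apply: filterS gh => x /= + _ => ->.
rewrite /Rintegral (ge0_integral_fibers _ _ _ mu K cell mcell); last 2 first.
- by apply/measurable_EFinP; exact: measurableT_comp.
- by move=> x; rewrite lee_fin.
rewrite -sum_fine//; apply: eq_bigr => k _; rewrite -!/(Rintegral _ _ _).
have -> : \int[mu]_(x in cell @^-1` [set k]) g x = \int[mu]_(x in cell @^-1` [set k]) h x.
  congr fine; apply: ae_eq_integral => //.
  - by apply/measurable_EFinP; exact: measurable_funTS.
  - by apply/measurable_EFinP; exact: measurable_funTS.
  - by apply: filterS gh => x /= + _ => ->.
case: (sgn k) => hk.
  rewrite ger0_norm ?Rintegral_ge0//; apply: eq_Rintegral => x.
  by rewrite inE => /hk h0; rewrite ger0_norm.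
have -> : \int[mu]_(x in cell @^-1` [set k]) `|h x| =
    \int[mu]_(x in cell @^-1` [set k]) (-1 * h x).
  by apply: eq_Rintegral => x; rewrite inE => /hk h0; rewrite ler0_norm// mulN1r.
have ge0 : 0 <= \int[mu]_(x in cell @^-1` [set k]) (-1 * h x).
  by apply: Rintegral_ge0 => x /hk; rewrite mulN1r oppr_ge0.
by move: ge0; rewrite RintegralZl// mulN1r oppr_ge0 => /ler0_norm.
Qed.

Context (muT : (mu setT < +oo)%E).

Let muA k : mu (cell @^-1` [set k]) \is a fin_num.
Proof.
rewrite ge0_fin_numE//; apply: le_lt_trans muT.
by apply: le_measure => //; rewrite inE.
Qed.

Lemma step_Lfun2 (c : K -> R) : (c \o cell) \in Lfun mu (2%:R%:E).
Proof.
have mc : measurable_fun setT (c \o cell).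
  move=> _ Y mY; rewrite setTI comp_preimage.
  rewrite (_ : cell @^-1` _ = \bigcup_(k in c @^-1` Y) (cell @^-1` [set k])).
    by apply: fin_bigcup_measurable => //; exact: finite_finset.
  by apply/seteqP; split=> [x /= Yx|x [k /= Yk ->]] //; exists (cell x).
apply/andP; split; rewrite inE//= /finite_norm unlock poweR_lty//.
rewrite (ge0_integral_fibers _ _ _ mu K cell mcell); last 2 first.
- apply: (@measurableT_comp _ _ _ _ _ _ (fun x : \bar R => x `^ 2)%E) => //.
    exact: measurable_poweR.
  by apply: measurableT_comp => //; apply/measurable_EFinP.
- by move=> x; exact: poweR_ge0.
apply: lte_sum_pinfty => k _.
rewrite (eq_integral (cst (`|c k|%:E `^ 2)%E)); last first.
  by move=> x; rewrite inE /= => ->.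
by rewrite integral_cst// poweR_EFin -ge0_fin_numE ?fin_numM// mule_ge0// lee_fin powR_ge0.
Qed.

Lemma exists_L1_L2_map (w : K -> R) : (forall k, 0 <= w k) ->
  exists2 S : {linear L1 -> L2}, continuous S &
    forall f, `|S f| ^+ 2 =
      \sum_k w k * (\int[mu]_(x in cell @^-1` [set k]) f x) ^+ 2.
Proof.
move=> w0; pose A k := cell @^-1` [set k].
pose m k : R := fine (mu (A k)).
pose c (f : L1) k := (\int[mu]_(x in A k) f x) * Num.sqrt (w k) / Num.sqrt (m k).
pose S f : L2 := Lclass (Lfun_Sub (lee1n 2) (step_Lfun2 (c f))).
have lin : linear S.
  move=> a f g; rewrite /S LclassZ LclassD; congr Lclass; apply/LfuneqP => x /=.
  transitivity (a * c f (cell x) + c g (cell x)) => //.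
  rewrite /c L1_Rintegral_linear; first by ring.
  exact: mcell.
have SE f : `|S f| ^+ 2 = \sum_k w k * (\int[mu]_(x in A k) f x) ^+ 2.
  rewrite (sum_fibers_sqr_norm _ _ _ mu K cell mcell muT (c f))//.
  apply: eq_bigr => k _; rewrite /c -/(A k) -/(m k).
  have m0 : 0 <= m k by rewrite fine_ge0.
  (* [m k] cannot be cancelled on a null cell, but the integral over it is 0 and both sides
     vanish. *)
  have [mz|mnz] := eqVneq (m k) 0.
    have -> : \int[mu]_(x in A k) f x = 0.
      rewrite /Rintegral null_set_integral//; first exact: mcell.
        by apply/measurable_EFinP; apply: measurable_funTS; exact: measurable_Lspace.
      by apply/eqP; rewrite -[X in X == _]fineK ?muA// -/(m k) mz.
    by rewrite !mul0r expr0n/= !(mul0r, mulr0).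
  rewrite !exprMn exprVn !sqr_sqrtr//; by field.
pose Sl : {linear L1 -> L2} := HB.pack S (GRing.isLinear.Build R L1 L2 _ S lin).
exists Sl => //; apply/linear_bounded_continuous/bounded_funP => r.
(* Each cell integral is at most the norm of [f], so the squared norm of [S f] is at most the total
   weight times the square of that norm. *)
exists (Num.sqrt (\sum_k w k) * r) => f fr.
have r0 : 0 <= r := le_trans (normr_ge0 _) fr.
have W0 : 0 <= \sum_k w k by apply: sumr_ge0.
rewrite -(@ler_pXn2r _ 2)// ?nnegrE ?mulr_ge0 ?sqrtr_ge0//.
rewrite [leLHS](SE f) exprMn sqr_sqrtr// mulr_suml; apply: ler_sum => k _.
rewrite ler_wpM2l// -[leLHS]ger0_norm ?sqr_ge0// normrX.
rewrite ler_pXn2r ?nnegrE//; apply: le_trans fr.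
by apply: L1_norm_Rintegral_le; exact: mcell.
Qed.

End fibers.

(** * Counting pairs, and cells given by order patterns *)

Lemma card_ord_pairs_lt (n : nat) :
  #|[pred ij : 'I_n * 'I_n | (ij.1 < ij.2)%N]| = 'C(n, 2).
Proof.
rewrite -sum1_card -bin2_sum big_mkord.
rewrite -(pair_big_dep xpredT (fun i j : 'I_n => (i < j)%N) (fun _ _ => 1%N)) /=.
rewrite (exchange_big_dep xpredT) //=; apply: eq_bigr => j _.
rewrite -(big_ord_widen n (fun=> 1%N) (ltnW (ltn_ord j))).
by rewrite sum1_card card_ord.
Qed.

(** The union bound for [l = ln n]: there are at most [n^2 / 2] pairs, each of cost [n^-2]. *)
Lemma binomial2_expR_ln_le (R : realType) (n : nat) : (0 < n)%N ->
  'C(n, 2)%:R * expR (- (2 * ln n%:R)) <= 1 / 2 :> R.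
Proof.
move=> n0; have nR : (0 : R) < n%:R by rewrite ltr0n.
have -> : 2 * ln n%:R = ln n%:R + ln n%:R :> R by ring.
rewrite expRN expRD lnK ?posrE// ler_pdivrMr ?mulr_gt0//.
have : ('C(n, 2).*2 <= n * n)%N.
  rewrite bin2 (leq_trans (_ : _ <= n * n.-1)%N) ?leq_mul2l ?leq_pred ?orbT//.
  by rewrite -[leqRHS]odd_double_half leq_addl.
by rewrite -(ler_nat R) -muln2 !natrM; lra.
Qed.

Section order_pattern.
Local Open Scope classical_set_scope.
Context d (T : measurableType d) (R : realType) (mu : {measure set T -> \bar R}).
Let L1 := LspaceType mu (@lexx _ _ 1%E).
Context (n : nat) (f : 'I_n -> L1).

Definition order_pattern (x : T) : {ffun 'I_n * 'I_n -> bool} :=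
  [ffun ij => f ij.1 x <= f ij.2 x].

Lemma measurable_order_pattern k : measurable (order_pattern @^-1` [set k]).
Proof.
rewrite (_ : _ @^-1` _ =
    \bigcap_(ij in setT) ((fun x => f ij.1 x <= f ij.2 x) @^-1` [set k ij])).
  apply: fin_bigcap_measurable => // ij _; rewrite -[X in measurable X]setTI.
  have : measurable_fun setT (fun x => f ij.1 x <= f ij.2 x).
    by apply: measurable_fun_ler; exact: measurable_Lspace.
  exact.
apply/seteqP; split=> [x /= <- ij _ /=|x h /=]; first by rewrite ffunE.
by apply/ffunP => ij; rewrite ffunE; exact: h.
Qed.

Lemma sum_norm_Rintegral_order_pattern (i j : 'I_n) :
  \sum_k `|\int[mu]_(x in order_pattern @^-1` [set k]) (f i - f j : L1) x| =
  `|f i - f j|.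
Proof.
(* Brought to the shape [a *: f + g] of [Lspace_linear_ae]. *)
rewrite (_ : f i - f j = -1 *: f j + f i); last by rewrite scaleN1r addrC.
apply: (sum_norm_Rintegral_fibers _ _ _ _ _ _ measurable_order_pattern _
  (fun x => -1 * f j x + f i x)).
- rewrite (_ : EFin \o _ = (fun x => (-1)%:E * (f j x)%:E) \+ (fun x => (f i x)%:E))%E//.
  apply: integrableD => //; last exact: L1_integrable.
  by apply: integrableZl => //; exact: L1_integrable.
- exact: Lspace_linear_ae.
- move=> k; case: (boolP (k (i, j))) => kij; [right|left] => x xk.
    by move: kij; rewrite -xk ffunE /= => h; lra.
  by move: kij; rewrite -xk ffunE /= -ltNge => h; lra.
Qed.

End order_pattern.

(** * Assembling the embedding over a finite measure *)

Section finite_subsets_of_L1.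
Local Open Scope classical_set_scope.

Lemma exists_L1_L2_embedding d (T : measurableType d) (R : realType)
    (mu : {measure set T -> \bar R}) (muT : (mu setT < +oo)%E)
    (n : nat) (n2 : (2 <= n)%N)
    (f : 'I_n -> LspaceType mu (@lexx _ _ 1%E)) (f_inj : injective f) :
  exists S : {linear LspaceType mu (@lexx _ _ 1%E) -> LspaceType mu (lee1n 2)},
    [/\ continuous S,
        forall i j : 'I_n, (i < j)%N ->
          `|S (f i) - S (f j)| / `|f i - f j| >= 1 / Num.sqrt (8 * ln n%:R)
      & 1 / ('C(n, 2))%:R *
        (\sum_(i < n) \sum_(j < n | (i < j)%N)
           (`|S (f i) - S (f j)| / `|f i - f j|) `^ (1 / 2)) <= 10].
Proof.
pose lt : {pred 'I_n * 'I_n} := [pred ij : 'I_n * 'I_n | (ij.1 < ij.2)%N].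
pose Q := {x in lt}.
have cardQ : #|{: Q}| = 'C(n, 2) by rewrite card_sig card_ord_pairs_lt.
pose K : finType := {ffun 'I_n * 'I_n -> bool}.
pose phi (k : K) (g : LspaceType mu (@lexx _ _ 1%E)) :=
  \int[mu]_(x in order_pattern _ _ _ mu n f @^-1` [set k]) g x.
pose dist (ij : 'I_n * 'I_n) := `|f ij.1 - f ij.2|.
have dist_gt0 ij : ij \in lt -> 0 < dist ij.
  rewrite /lt inE normr_gt0 subr_eq0 => lij; apply/eqP => /f_inj ij0.
  by rewrite ij0 ltnn in lij.
pose a (q : Q) k := phi k (f (val q).1 - f (val q).2) / dist (val q).
have l0 : 0 < ln (n%:R : R) by rewrite ln_gt0// ltr1n.
have [] := exists_weights R Q K a (ln n%:R) l0.
- move=> q; have d0 := dist_gt0 _ (valP q).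
  under eq_bigr do rewrite normrM normfV (gtr0_norm d0).
  by rewrite -mulr_suml sum_norm_Rintegral_order_pattern divff// gt_eqF.
- by rewrite cardQ; apply: binomial2_expR_ln_le; apply: ltnW.
move=> w [w0 lo hi].
have [S contS SE] := exists_L1_L2_map _ _ _ mu _ _ (measurable_order_pattern _ _ _ mu n f) muT w w0.
have ratioE (q : Q) : `|S (f (val q).1) - S (f (val q).2)| / dist (val q) =
    Num.sqrt (\sum_k w k * a q k ^+ 2).
  have d0 := dist_gt0 _ (valP q).
  rewrite -linearB.
  have <- : (`|S (f (val q).1 - f (val q).2)| / dist (val q)) ^+ 2 =
      \sum_k w k * a q k ^+ 2.
    rewrite exprMn SE mulr_suml; apply: eq_bigr => k _.
    by rewrite [in RHS]/a exprMn [in RHS]mulrA.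
  by rewrite sqrtr_sqr ger0_norm// divr_ge0// ltW.
exists S; split => //.
- move=> i j ij; have ijQ : (i, j) \in lt by [].
  have := ratioE (exist _ (i, j) ijQ); rewrite /dist /= => ->.
  have l8 : 0 <= 8 * ln (n%:R : R) by rewrite mulr_ge0 ?(ltW l0).
  rewrite !div1r -sqrtrV; last exact: l8.
  apply: ler_wsqrtr.
  by rewrite -div1r; exact: lo.
- have C0 : (0 : R) < ('C(n, 2))%:R by rewrite ltr0n bin_gt0.
  rewrite mul1r mulrC ler_pdivrMr// -cardQ; apply: le_trans hi.
  rewrite (pair_big_dep xpredT (fun i j : 'I_n => (i < j)%N)) /=.
  rewrite (big_sub lt) /= le_eqVlt; apply/orP; left; apply/eqP.
  apply: eq_bigr => q _.
  by rewrite [X in X `^ _](ratioE q) div1r powR12_sqrt ?sqrtr_ge0.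
Qed.

End finite_subsets_of_L1.

Theorem theorem1p1 (R : realType) (n : nat) (n2 : (2 <= n)%N)
    (f : 'I_n -> L1 R) (f_inj : injective f) :
  exists T : {linear L1 R -> L2 R},
    [/\ continuous T,
        forall i j : 'I_n, (i < j)%N ->
          `|T (f i) - T (f j)| / `|f i - f j| >= 1 / Num.sqrt (8 * ln n%:R)
      & 1 / ('C(n, 2))%:R *
        (\sum_(i < n) \sum_(j < n | (i < j)%N)
           (`|T (f i) - T (f j)| / `|f i - f j|) `^ (1 / 2)) <= 10].
Proof.
apply: exists_L1_L2_embedding => //.
rewrite /lebesgue01 /= /mrestr setTI lebesgue_measure_itv /= lte_fin ltr01.
by rewrite -EFinD ltry.
Qed.
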